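(* Let $f:\mathbb{R}^n\to\mathbb{R}$ be convex and differentiable, with finite curvature constant $C_f$ with respect to the cube $\Box_n:=\{x\in\mathbb{R}^n : \|x\|_\infty\le1\}$. Let $x^*\in\Box_n$ be an optimal solution of $\min_{\|x\|_\infty\le1}f(x)$. For each $k\ge1$, the iterate $x^{(k)}$ of the algorithm ''Sparse Greedy on the Cube'' satisfies $$f(x^{(k)})-f(x^* )\le\frac{4C_f}{k+2}.$$ Furthermore, for any $\varepsilon>0$, after at most $2\left\lceil\frac{4C_f}{\varepsilon}\right\rceil+1=O\left(\frac1\varepsilon\right)$ many steps, the algorithm (with the step-size in the second half of the iterations fixed to $\frac{2}{K+2}$, where $K:=\lceil4C_f/\varepsilon\rceil$) has an iterate $x^{(k)}$ with $g(x^{(k)})\le\varepsilon$.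
   Context: The $O(\cdot)$ is for $\varepsilon\to0$, with constant depending only on $C_f$. Curvature constant, with $D=\Box_n$: $$C_f:=\sup_{\substack{x,s\in D,\ \alpha\in(0,1],\\ y=x+\alpha(s-x)}}\frac{1}{\alpha^2}\bigl(f(y)-f(x)-(y-x)^T\nabla f(x)\bigr).$$ Duality gap at $x\in\Box_n$: $g(x):=\max_{y\in\Box_n}(x-y)^T\nabla f(x)=\|\nabla f(x)\|_1+x^T\nabla f(x)$. Algorithm ''Sparse Greedy on the Cube'': set $x^{(0)}:=0$. For $k=0,1,2,\dots$: compute the sign-vector $\mathbf{s}\in\{-1,1\}^n$ with $\mathbf{s}_i=\mathrm{sign}\bigl((-\nabla f(x^{(k)}))_i\bigr)$ for $i=1,\dots,n$ (either sign may be used for zero coordinates), let $\alpha:=\frac{2}{k+2}$, and update $x^{(k+1)}:=x^{(k)}+\alpha(\mathbf{s}-x^{(k)})$. For the duality gap statement, the step-sizes are $\alpha=\frac{2}{k+2}$ for $0\le k\le K$ and $\alpha=\frac{2}{K+2}$ for $K\le k\le2K+1$. *)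

(* Defs.v *)
From HB Require Import structures.
From mathcomp Require Import all_boot all_order all_algebra.
From mathcomp Require Import all_classical all_reals all_analysis.

Set Implicit Arguments.
Unset Strict Implicit.
Unset Printing Implicit Defensive.

Import Order.TTheory GRing.Theory Num.Theory.
Import numFieldNormedType.Exports.

Local Open Scope classical_set_scope.
Local Open Scope ring_scope.

Definition dot (R : realType) (n : nat) (u v : 'rV[R]_n) : R :=
  (u *m v^T) 0 0.

Definition grad (R : realType) (n : nat) (f : 'rV[R]_n -> R) (x : 'rV[R]_n) :
  'rV[R]_n := \row_i 'D_(delta_mx 0 i) f x.

(* The library norm on matrices is the sup norm. *)
Definition cube (R : realType) (n : nat) : set 'rV[R]_n :=
  [set x | `|x| <= 1].
Arguments cube : clear implicits.

Definition curvature (R : realType) (n : nat) (D : set 'rV[R]_n)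
    (f : 'rV[R]_n -> R) : \bar R :=
  ereal_sup [set c | exists x s y : 'rV[R]_n, exists alpha : R,
    [/\ D x, D s, 0 < alpha <= 1, y = x + alpha *: (s - x)
      & c = ((alpha ^+ 2)^-1 * (f y - f x - dot (y - x) (grad f x)))%:E]].

Definition duality_gap (R : realType) (n : nat) (f : 'rV[R]_n -> R)
    (x : 'rV[R]_n) : R :=
  sup [set dot (x - y) (grad f x) | y in cube R n].

(* A coordinate where the gradient vanishes may get either sign. *)
Definition greedy_sign (R : realType) (n : nat) (f : 'rV[R]_n -> R)
    (x s : 'rV[R]_n) : Prop :=
  forall i, (s 0 i = 1 \/ s 0 i = -1) /\
    (grad f x 0 i != 0 -> s 0 i = Num.sg (- grad f x 0 i)).

(* [x] is a sequence of iterates of the algorithm with step sizes [alpha].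
   A relation and not a function, since the sign vector is not determined. *)
Definition sparse_greedy_cube (R : realType) (n : nat) (f : 'rV[R]_n -> R)
    (alpha : nat -> R) (x : nat -> 'rV[R]_n) : Prop :=
  x 0 = 0 /\
  forall k, exists2 s, greedy_sign f (x k) s &
    x k.+1 = x k + alpha k *: (s - x k).

Definition greedy_step (R : realType) (k : nat) : R := 2 / (k%:R + 2).

Definition two_phase_step (R : realType) (K k : nat) : R :=
  if (k <= K)%N then greedy_step R k else greedy_step R K.

(* The ceiling is an [int]; the absolute value only converts it to [nat],
   the ratio being nonnegative for a curvature constant [C]. *)
Definition gap_horizon (R : realType) (C eps : R) : nat :=
  `|Num.ceil (4 * C / eps)|%N.

(* So the supremum in [duality_gap] is a maximum. *)
Lemma duality_gap_max (R : realType) (n : nat) (f : 'rV[R]_n -> R)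
    (x : 'rV[R]_n) :
  (exists2 y, cube R n y & duality_gap f x = dot (x - y) (grad f x)) /\
  duality_gap f x = \sum_i `|grad f x 0 i| + dot x (grad f x).
Proof.
set g := grad f x.
have dotE (u v : 'rV[R]_n) : dot u v = \sum_i u 0 i * v 0 i.
  by rewrite /dot mxE; apply: eq_bigr => i _; rewrite mxE.
have dotB (u v w : 'rV[R]_n) : dot (u - v) w = dot u w - dot v w.
  by rewrite /dot mulmxBl !mxE.
pose y0 : 'rV[R]_n := \row_i - Num.sg (g 0 i).
have cubeP (y : 'rV[R]_n) : cube R n y <-> forall i, `|y 0 i| <= 1.
  rewrite /cube /= {1}/Num.norm /= mx_normrE; split.
    by move=> /bigmax_leP [_ h] i; exact: (h (0, i)).
  move=> h; apply/bigmax_leP; split => // -[i j] _ /=.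
  by rewrite (ord1 i).
have Cy0 : cube R n y0.
  by apply/cubeP => i; rewrite mxE normrN normr_sg; case: (g 0 i != 0).
have y0E : dot (x - y0) g = \sum_i `|g 0 i| + dot x g.
  rewrite dotB (dotE y0) addrC; congr (_ + _).
  rewrite -sumrN; apply: eq_bigr => i _.
  by rewrite mxE mulNr opprK normrEsg.
have ub (y : 'rV[R]_n) : cube R n y -> dot (x - y) g <= dot (x - y0) g.
  move=> /cubeP Cy; rewrite y0E dotB addrC lerD2r dotE -sumrN.
  apply: ler_sum => i _; apply: le_trans (ler_norm _) _.
  by rewrite normrN normrM ler_piMl.
have gE : duality_gap f x = dot (x - y0) g.
  apply/eqP; rewrite eq_le; apply/andP; split.
    apply: ge_sup; first by exists (dot (x - y0) g), y0.
    by move=> _ [y Cy <-]; exact: ub.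
  apply: ub_le_sup; last by exists y0.
  by exists (dot (x - y0) g) => _ [y Cy <-]; exact: ub.
by split; [exists y0 | rewrite gE].
Qed.

(* Main.v *)
Require Import Defs.
From HB Require Import structures.
From mathcomp Require Import all_boot all_order all_algebra.
From mathcomp Require Import all_classical all_reals all_analysis.
From mathcomp Require Import zify ring lra.

Import Order.TTheory GRing.Theory Num.Theory.
Import numFieldNormedType.Exports.

Local Open Scope classical_set_scope.
Local Open Scope ring_scope.

(** Moving by a fraction [a] of the way towards another point of the cube, the
    objective exceeds its linearization by at most [a ^+ 2 * C], and the sign
    vector minimizes that linearization over the cube.  Write [h k] for the
    primal error and [g k] for the duality gap of the [k]-th iterate; one step
    of size [a] then gives

      [h k.+1 <= h k - a * g k + a ^+ 2 * C]     ([greedy_step_progress]).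

    Convexity gives [h k <= g k] ([primal_error_le_gap]), and both error bounds
    follow from these two inequalities and from [0 <= h k].

    Primal rate: bounding [g k] below by [h k] yields
    [h k.+1 <= (1 - a) * h k + a ^+ 2 * C], and with [a = 2 / (k + 2)] the bound
    [4 * C / (k + 2)] propagates by induction ([primal_rate]).  The first step
    has [a = 1], so nothing has to be known about [h 0].

    Gap: suppose that [4 * C <= K * eps] and that every gap up to index
    [2 * K + 1] exceeds [eps].  Each of the [K + 1] steps that lead from iterate
    [K + 1] to iterate [2 * K + 2] has size [2 / (K + 2)] and lowers the primal
    error by more than [2 / (K + 2) * eps - 4 * C / (K + 2) ^+ 2].  The total
    decrease exceeds the error [4 * C / (K + 3)] that is left at iterate
    [K + 1], so [h] would become negative ([gap_rate]).  Counting from [K + 1]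
    and not from [K] makes the primal rate available even when [K = 0].

    The horizon [K] is within [1] of [4 * C / eps] when [C] is nonnegative, and
    at most [4 * `|C| / eps + 1] in general, whence the order of growth
    ([gap_horizon_bigO]). *)

(** * First-order bounds for convex functions *)

Lemma dotE (R : realType) (n : nat) (u v : 'rV[R]_n) :
  dot u v = \sum_i u 0 i * v 0 i.
Proof. by rewrite /dot mxE; apply: eq_bigr => i _; rewrite mxE. Qed.

Lemma dotBl (R : realType) (n : nat) (u v w : 'rV[R]_n) :
  dot (u - v) w = dot u w - dot v w.
Proof. by rewrite /dot mulmxBl !mxE. Qed.

Lemma dotZl (R : realType) (n : nat) (a : R) (u w : 'rV[R]_n) :
  dot (a *: u) w = a * dot u w.
Proof. by rewrite /dot -scalemxAl mxE. Qed.

Lemma derive_grad (R : realType) (n : nat) (f : 'rV[R]_n -> R)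
    (x v : 'rV[R]_n) :
  differentiable f x -> 'D_v f x = dot v (grad f x).
Proof.
move=> df; rewrite deriveE // [in LHS](row_sum_delta v) linear_sum dotE.
by apply: eq_bigr => i _; rewrite linearZ /= mxE deriveE.
Qed.

(** The slopes of [f] along the segment from [x] to [y] are at most
    [f y - f x] by convexity, and they converge to the directional
    derivative. *)
Lemma convex_above_tangent (R : realType) (n : nat) (f : 'rV[R]_n -> R)
    (x y : 'rV[R]_n) :
  convex_function [set: 'rV[R]_n] f -> differentiable f x ->
  dot (y - x) (grad f x) <= f y - f x.
Proof.
move=> cf df; rewrite -derive_grad //.
have dv : derivable f x (y - x) by exact: diff_derivable.
rewrite /derive (cvg_at_rightE
  (fun h : R => h^-1 *: (f (h *: (y - x) + x) - f x))) //.
apply: limr_le.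
  apply: (cvgP _ (cvg_trans _ dv)); apply: cvg_app => A [e e0 eA].
  by exists e => // t te t0; apply: eA => //; exact: lt0r_neq0.
near=> t.
have t0 : 0 < t by near: t; exact: nbhs_right_gt.
have t1 : t <= 1 by near: t; apply: nbhs_right_le.
rewrite /GRing.scale /= ler_pdivrMl //.
have := cf (Itv01 (ltW t0) t1) y x; rewrite !in_setT => /(_ isT isT).
rewrite convRE.
have -> : conv (Itv01 (ltW t0) t1) (y : convex_lmodType 'rV[R]_n) x
    = t *: (y - x) + x.
  rewrite /conv /= /unstable.onem scalerBl scale1r scalerBr.
  by rewrite -!addrA [- _ + x]addrC.
by rewrite /= /unstable.onem; lra.
Unshelve. all: by end_near.
Qed.

(** * The greedy step on the cube *)

Lemma cubeP (R : realType) (n : nat) (y : 'rV[R]_n) :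
  cube R n y <-> forall i, `|y 0 i| <= 1.
Proof.
rewrite /cube /= {1}/Num.norm /= mx_normrE; split.
  by move=> /bigmax_leP [_ h] i; exact: (h (0, i)).
move=> h; apply/bigmax_leP; split => // -[i j] _ /=.
by rewrite (ord1 i).
Qed.

Lemma cube0 (R : realType) (n : nat) : cube R n 0.
Proof. by rewrite /cube /= normr0. Qed.

Lemma cube_segment (R : realType) (n : nat) (a : R) (x s : 'rV[R]_n) :
  0 <= a <= 1 -> cube R n x -> cube R n s -> cube R n (x + a *: (s - x)).
Proof.
move=> /andP[a0 a1] /= Cx Cs.
have -> : x + a *: (s - x) = (1 - a) *: x + a *: s.
  by rewrite scalerBr scalerBl scale1r addrA addrAC.
apply: le_trans (ler_normD _ _) _; rewrite !normrZ (ger0_norm a0).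
rewrite ger0_norm ?subr_ge0 // [leRHS](_ : 1 = (1 - a) * 1 + a * 1); last by ring.
by apply: lerD; apply: ler_wpM2l; rewrite ?subr_ge0.
Qed.

Lemma greedy_sign_cube (R : realType) (n : nat) (f : 'rV[R]_n -> R)
    (x s : 'rV[R]_n) : greedy_sign f x s -> cube R n s.
Proof.
by move=> hs; apply/cubeP => i; have [[] -> _] := hs i; rewrite ?normrN normr1.
Qed.

(** The sign vector attains the maximum that defines the duality gap. *)
Lemma dot_greedy_sign (R : realType) (n : nat) (f : 'rV[R]_n -> R)
    (x s : 'rV[R]_n) :
  greedy_sign f x s -> dot (s - x) (grad f x) = - duality_gap f x.
Proof.
move=> hs; rewrite (duality_gap_max f x).2 dotBl opprD; congr (_ - _).
rewrite dotE -sumrN; apply: eq_bigr => i _; have [_ hsi] := hs i.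
have [-> |gi] := eqVneq (grad f x 0 i) 0; first by rewrite normr0 mulr0 oppr0.
by rewrite hsi // sgrN mulNr -normrEsg.
Qed.

Lemma curvature_bound (R : realType) (n : nat) (f : 'rV[R]_n -> R) (C a : R)
    (x s : 'rV[R]_n) :
  curvature (cube R n) f = C%:E -> cube R n x -> cube R n s -> 0 < a <= 1 ->
  f (x + a *: (s - x)) - f x - a * dot (s - x) (grad f x) <= a ^+ 2 * C.
Proof.
move=> fC Cx Cs a01; have /andP[a0 _] := a01.
rewrite -ler_pdivrMl ?exprn_gt0 // -lee_fin -fC; apply: ereal_sup_ubound.
exists x, s, (x + a *: (s - x)), a; split => //.
by rewrite [x + _ - x]addrC addKr dotZl.
Qed.

(** The choice [s = x] makes the quotient under the supremum vanish. *)
Lemma curvature_ge0 (R : realType) (n : nat) (f : 'rV[R]_n -> R) (C : R) :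
  curvature (cube R n) f = C%:E -> 0 <= C.
Proof.
move=> fC; have C0 := cube0 R n.
have := @curvature_bound R n f C 1 0 0 fC C0 C0.
rewrite ltr01 lexx => /(_ isT).
by rewrite subrr scaler0 addr0 subrr /dot mul0mx mxE mulr0 subr0 expr1n mul1r.
Qed.

Lemma greedy_step_progress (R : realType) (n : nat) (f : 'rV[R]_n -> R)
    (C a : R) (x s : 'rV[R]_n) :
  curvature (cube R n) f = C%:E -> cube R n x -> greedy_sign f x s ->
  0 < a <= 1 ->
  f (x + a *: (s - x)) <= f x - a * duality_gap f x + a ^+ 2 * C.
Proof.
move=> fC Cx hs a01.
have := curvature_bound _ _ _ _ _ _ _ fC Cx (greedy_sign_cube _ _ _ _ _ hs) a01.
by rewrite dot_greedy_sign // mulrN opprK; lra.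
Qed.

Lemma primal_error_le_gap (R : realType) (n : nat) (f : 'rV[R]_n -> R)
    (x y : 'rV[R]_n) :
  convex_function [set: 'rV[R]_n] f -> differentiable f x -> cube R n y ->
  f x - f y <= duality_gap f x.
Proof.
move=> cf df Cy; have := convex_above_tangent _ _ _ x y cf df.
have : dot (x - y) (grad f x) <= duality_gap f x.
  rewrite (duality_gap_max f x).2 dotBl addrC lerD2r dotE -sumrN.
  apply: ler_sum => i _; apply: le_trans (ler_norm _) _.
  rewrite normrN normrM ler_piMl //.
  by move/cubeP: Cy.
have -> : dot (x - y) (grad f x) = - dot (y - x) (grad f x).
  by rewrite !dotBl opprB.
lra.
Qed.

Lemma sparse_greedy_in_cube (R : realType) (n : nat) (f : 'rV[R]_n -> R)
    (a : nat -> R) (x : nat -> 'rV[R]_n) :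
  (forall k, 0 < a k <= 1) -> sparse_greedy_cube f a x ->
  forall k, cube R n (x k).
Proof.
move=> a01 [x0 xS]; elim=> [|k IHk]; first by rewrite x0; exact: cube0.
have [s hs ->] := xS k; have /andP[/ltW a0 a1] := a01 k.
by apply: cube_segment => //; [rewrite a0 a1 | exact: greedy_sign_cube hs].
Qed.

(** * The two recursions *)

Lemma greedy_step_itv (R : realType) (k : nat) : 0 < greedy_step R k <= 1.
Proof.
have k0 : 0 <= k%:R :> R by [].
by rewrite /greedy_step divr_gt0 ?ler_pdivrMr; lra.
Qed.

Lemma two_phase_step_itv (R : realType) (K k : nat) :
  0 < two_phase_step R K k <= 1.
Proof. by rewrite /two_phase_step; case: ifP => _; exact: greedy_step_itv. Qed.

(** With [a = 2 / (k + 2)] the recursion turns [4 * C / (k + 2)] into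
    [4 * C * (k + 1) / (k + 2) ^+ 2], and [(k + 1) * (k + 3) <= (k + 2) ^+ 2].
    The cutoff [N] lets the bound also serve the first phase of the two-phase
    schedule. *)
Lemma primal_rate (R : realType) (C : R) (a h g : nat -> R) (N : nat) :
  0 <= C -> (forall k, h k <= g k) ->
  (forall k, h k.+1 <= h k - a k * g k + a k ^+ 2 * C) ->
  (forall k, (k < N)%N -> a k = greedy_step R k) ->
  forall k, (1 <= k <= N)%N -> h k <= 4 * C / (k%:R + 2).
Proof.
move=> C0 hg hS aE; elim=> // k IHk /= kN.
have k0 : 0 <= k%:R :> R by [].
have := hS k; rewrite aE // /greedy_step.
have -> : k.+1%:R + 2 = k%:R + 3 :> R by rewrite -natr1; ring.
have /(_ k) hgk := hg.
(* The factor [k] makes the induction hypothesis usable from [k = 0] on,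
   where the bound itself may fail. *)
have Hk : k%:R * (h k * (k%:R + 2) - 4 * C) <= 0.
  case: (posnP k) => [-> | k1]; first by rewrite mul0r.
  apply: mulr_ge0_le0 => //; rewrite subr_le0 -ler_pdivlMr; last by lra.
  by apply: IHk; rewrite k1 ltnW.
set z : R := k%:R in k0 Hk *.
move=> hk; apply: le_trans hk _.
have z2 : 0 < z + 2 by lra.
apply: (@le_trans _ _ (z / (z + 2) * h k + (2 / (z + 2)) ^+ 2 * C)).
  have /(ler_wpM2l) : 0 <= 2 / (z + 2) by apply: divr_ge0; lra.
  move=> /(_ _ _ hgk) H.
  have -> : z / (z + 2) * h k = h k - 2 / (z + 2) * h k by field; lra.
  by rewrite lerD2r lerD2l lerN2.
rewrite ler_pdivlMr; last by lra.
have -> : (z / (z + 2) * h k + (2 / (z + 2)) ^+ 2 * C) * (z + 3)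
   = (z * (h k * (z + 2)) + 4 * C) * (z + 3) / (z + 2) ^+ 2 by field; lra.
rewrite ler_pdivrMr ?exprn_gt0 //.
have P : z * (h k * (z + 2) - 4 * C) * (z + 3) <= 0.
  by apply: mulr_le0_ge0 => //; lra.
have Q : (z * (h k * (z + 2)) + 4 * C) * (z + 3) =
   z * (h k * (z + 2) - 4 * C) * (z + 3) + 4 * C * ((z + 2) ^+ 2 - 1) by ring.
by rewrite Q; lra.
Qed.

(** A gap above [eps] makes each second-phase step decrease the error by more
    than [d]; after [K + 1] such steps more has been lost than the primal rate
    left at [K + 1]. *)
Lemma gap_rate (R : realType) (C eps : R) (h g : nat -> R) (K : nat) :
  0 <= C -> 0 < eps -> 4 * C <= K%:R * eps ->
  (forall k, 0 <= h k <= g k) ->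
  (forall k, h k.+1 <= h k - two_phase_step R K k * g k
                       + two_phase_step R K k ^+ 2 * C) ->
  exists2 k, (k <= 2 * K + 1)%N & g k <= eps.
Proof.
move=> C0 eps0 CK hg hS.
have hK1 : h K.+1 <= 4 * C / (K.+1%:R + 2).
  apply: (primal_rate _ C (two_phase_step R K) h g K.+1) => //.
  - by move=> k; have /andP[] := hg k.
  - by move=> k; rewrite ltnS /two_phase_step => ->.
  - by rewrite leqnn.
apply: contrapT => no.
have geps k : (k <= 2 * K + 1)%N -> eps < g k.
  move=> kK; rewrite ltNge; apply/negP => gk; by apply: no; exists k.
set b := greedy_step R K.
have b0 : 0 < b by have /andP[] := greedy_step_itv R K.
pose d := b * eps - b ^+ 2 * C.
have descent m : (m <= K)%N -> h (K.+1 + m.+1)%N < h K.+1 - m.+1%:R * d.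
  have step k : (K < k <= 2 * K + 1)%N -> h k.+1 < h k - d.
    move=> /andP[Kk kK]; have := hS k; rewrite /two_phase_step leqNgt Kk /= -/b.
    have := geps _ kK; rewrite -(ltr_pM2l b0) /d => H1 H2.
    by lra.
  elim: m => [|m IHm] mK; first by rewrite addn1 mul1r; apply: step; lia.
  have := IHm (ltnW mK); have := step (K.+1 + m.+1)%N.
  have -> : (K < K.+1 + m.+1 <= 2 * K + 1)%N by lia.
  move=> /(_ isT); rewrite [in h (K.+1 + m.+2)%N]addnS.
  rewrite -[m.+2%:R]natr1 mulrDl mul1r.
  lra.
have := descent K (leqnn K); have /andP[hpos _] := hg (K.+1 + K.+1)%N.
suff : 4 * C / (K.+1%:R + 2) <= K.+1%:R * d by lra.
rewrite -[K.+1%:R]natr1 /d /b /greedy_step.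
have K0 : 0 <= K%:R :> R by [].
set z : R := K%:R in CK K0 *.
rewrite ler_pdivrMr; last by lra.
have -> : (z + 1) * (2 / (z + 2) * eps - (2 / (z + 2)) ^+ 2 * C) * (z + 1 + 2) =
   (z + 1) * (2 * (z + 2) * eps - 4 * C) * (z + 3) / (z + 2) ^+ 2.
  by field; lra.
rewrite ler_pdivlMr; last by apply: exprn_gt0; lra.
(* Eliminating [C] through [4 * C <= z * eps] on both sides leaves a polynomial
   inequality in [z] alone. *)
apply: (@le_trans _ _ (z * eps * (z + 2) ^+ 2)).
  by apply: ler_wpM2r => //; apply: exprn_ge0; lra.
apply: (@le_trans _ _ ((z + 1) * ((z + 4) * eps) * (z + 3))); last first.
  by apply: ler_wpM2r; [lra | apply: ler_wpM2l; lra].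
rewrite -subr_ge0.
have -> : (z + 1) * ((z + 4) * eps) * (z + 3) - z * eps * (z + 2) ^+ 2 =
    eps * (4 * z ^+ 2 + 15 * z + 12) by ring.
by apply: mulr_ge0; [exact: ltW | nra].
Qed.

(** * The horizon of the two-phase schedule *)

Lemma gap_horizon_ge (R : realType) (C eps : R) :
  4 * C / eps <= (gap_horizon C eps)%:R.
Proof.
apply: le_trans (ceil_ge _) _; rewrite /gap_horizon natr_absz ler_int.
exact: ler_norm.
Qed.

Lemma gap_horizon_le (R : realType) (C eps : R) :
  0 < eps -> (gap_horizon C eps)%:R <= 4 * `|C| / eps + 1.
Proof.
move=> eps0; rewrite /gap_horizon natr_absz intr_norm ler_norml.
have /andP[lo hi] := ceil_itv (4 * C / eps).
rewrite intrD in lo.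
have N : `|4 * C / eps| = 4 * `|C| / eps.
  by rewrite !normrM normfV (gtr0_norm eps0) ger0_norm.
have := ler_norm (4 * C / eps); have := ler_norm (- (4 * C / eps)).
rewrite normrN N; lra.
Qed.

Lemma gap_horizon_bigO (R : realType) (C : R) :
  (fun eps : R => (2 * gap_horizon C eps + 1)%:R : R^o) =O_ (0^'+)
    (fun eps : R => eps^-1 : R^o).
Proof.
apply/eqO_exP; exists (8 * `|C| + 3); first by have := normr_ge0 C; lra.
near=> eps.
have e0 : 0 < eps by near: eps; exact: nbhs_right_gt.
have e1 : eps <= 1 by near: eps; exact: nbhs_right_le.
rewrite normr_nat (gtr0_norm (_ : 0 < eps^-1)) ?invr_gt0 //.
have := gap_horizon_le _ C _ e0; rewrite natrD natrM.
have : 1 <= eps^-1 by rewrite invf_ge1.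
set i := eps^-1; nra.
Unshelve. all: by end_near.
Qed.

Theorem theorem15 (R : realType) (C : R) :
  (forall (n : nat) (f : 'rV[R]_n -> R)
      (f_convex : convex_function [set: 'rV[R]_n] f)
      (f_diff : forall x, differentiable f x)
      (f_curvature : curvature (cube R n) f = C%:E)
      (xopt : 'rV[R]_n) (xopt_cube : cube R n xopt)
      (xopt_min : forall y, cube R n y -> f xopt <= f y),
    (forall x, sparse_greedy_cube f (greedy_step R) x ->
      forall k, (1 <= k)%N -> f (x k) - f xopt <= 4 * C / (k%:R + 2)) /\
    (forall eps : R, 0 < eps ->
      forall x, sparse_greedy_cube f (two_phase_step R (gap_horizon C eps)) x ->
      exists2 k, (k <= 2 * gap_horizon C eps + 1)%N &
        duality_gap f (x k) <= eps)) /\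
  (fun eps : R => (2 * gap_horizon C eps + 1)%:R : R^o) =O_ (0^'+)
    (fun eps : R => eps^-1 : R^o).
Proof.
split; last exact: gap_horizon_bigO.
move=> n f f_convex f_diff f_curvature xopt xopt_cube xopt_min.
have C0 := curvature_ge0 _ _ _ _ f_curvature.
have err_gap x : f x - f xopt <= duality_gap f x.
  exact: primal_error_le_gap.
have progress a x : (forall k, 0 < a k <= 1) -> sparse_greedy_cube f a x ->
    forall k, f (x k.+1) - f xopt <=
      f (x k) - f xopt - a k * duality_gap f (x k) + a k ^+ 2 * C.
  move=> a01 run k; have [s hs ->] := run.2 k.
  have Cx := sparse_greedy_in_cube _ _ _ _ _ a01 run k.
  have := greedy_step_progress _ _ _ _ _ _ _ f_curvature Cx hs (a01 k).
  lra.
split=> [x run k k1 | eps eps0 x run].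
  apply: (primal_rate _ C (greedy_step R) (fun k => f (x k) - f xopt)
    (fun k => duality_gap f (x k)) k) => //; last by rewrite k1 leqnn.
  exact: progress (greedy_step_itv R) run.
have step_itv := two_phase_step_itv R (gap_horizon C eps).
apply: (gap_rate _ C eps (fun k => f (x k) - f xopt)) => //.
- by rewrite -ler_pdivrMr //; exact: gap_horizon_ge.
- move=> k; rewrite err_gap subr_ge0 andbT; apply: xopt_min.
  exact: sparse_greedy_in_cube run k.
- exact: progress.
Qed.
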